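(* Suppose that $(x^\star,m^\star)$ is an optimal solution of the reward design problem and that $x^\star$ is an interior point of $\mathcal P_{m^\star}$. For $\delta>0$ let $m_\delta^\star\in\arg\min_{m\in\mathsf{BR}_\delta(x^\star)}\langle r_1,m\rangle$, and let $\mathcal M_{\mathrm{det}}^\star=\mathcal M_{\mathrm{det}}\cap\mathsf{BR}(x^\star)$. Then for any $\delta>0$, $$\langle r_1,m_\delta^\star\rangle\ \ge\ \Big(1-\frac{\delta}{b}\Big)\langle r_1,m^\star\rangle,$$ where $b=\langle r_2^{x^\star},m^\star\rangle-\max_{m\in\mathcal M_{\mathrm{det}}\setminus\mathcal M_{\mathrm{det}}^\star}\langle r_2^{x^\star},m\rangle$.
   Context: Setting. $\mathcal S$ and $\mathcal A$ are finite nonempty sets (states, actions); $\mathcal T:\mathcal S\times\mathcal A\times\mathcal S\to[0,1]$ is a transition kernel ($\mathcal T(s,a,s')$ is the probability of moving from $s$ to $s'$ under action $a$); $r:\mathcal S\times\mathcal A\to\mathbb R$; $\gamma\in(0,1)$; $\rho$ is a probability distribution on $\mathcal S$ (initial distribution). A policy is $\pi:\mathcal S\times\mathcal A\to[0,1]$ with $\sum_a\pi(s,a)=1$ for all $s$; it is deterministic if for every $s$ some $a$ has $\pi(s,a)=1$. The occupancy measure induced by $\pi$ is $m^\pi(s,a)=\sum_{t\ge0}\gamma^t\,\mathbb P_\pi(s_t=s,a_t=a)$ with $s_0\sim\rho$. The set of occupancy measures is $\mathcal M=\{m\in\mathbb R^{\mathcal S\times\mathcal A}: m\ge0,\ \sum_a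 m(s,a)=\rho(s)+\gamma\sum_{s',a'}\mathcal T(s',a',s)m(s',a')\ \forall s\in\mathcal S\}$ (these are exactly the $m^\pi$), and $\mathcal M_{\mathrm{det}}$ is the set of those induced by deterministic policies. For $f\in\mathbb R^{\mathcal S\times\mathcal A}$, $\langle f,m\rangle=\sum_{s,a}f(s,a)m(s,a)$. $\mathcal S_d\subseteq\mathcal S$ is a nonempty set of states at which reward can be allocated; a reward allocation is $x\in\mathbb R^{\mathcal S_d}$; with budget $C\ge0$ the admissible allocations are $\mathcal X=\{x: x\ge0,\ \sum_{s\in\mathcal S_d}x(s)\le C\}$. The follower's modified reward is $r_2^x(s,a)=r(s,a)+x(s)$ if $s\in\mathcal S_d$ and $r_2^x(s,a)=r(s,a)$ otherwise. The leader's reward is $r_1(s,a)=1$ if $s\in\mathcal S_d$ and $0$ otherwise. Best responses: $\mathsf{BR}(x)=\arg\max_{m\in\mathcal M}\langle r_2^x,m\rangle$; $\delta$-optimal responses: $\mathsf{BR}_\delta(x)=\{m\in\mathcal M:\max_{m'\in\mathcal M}\langle r_2^x,m'\rangle-\langle r_2^x,m\rangle\le\delta\}$. The reward design problem is: maximize $\langle r_1,m\rangle$ over $x\in\mathcal X$, $m\in\mathcal M$ subject to $m\in\mathsf{BR}(x)$. The allocation region of $m\in\mathcal M$ is $\mathcal P_m=\{x\in\mathbb R^{\mathcal S_d}: m\in\mathsf{BR}(x)\}$. Convention: the maximum over the empty set is $-\infty$ (so then $b=+\infty$ and $1/b=0$). *)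

(* Defs.v *)
From mathcomp Require Import all_boot all_order all_algebra.
From mathcomp Require Import all_classical all_reals all_analysis.

Set Implicit Arguments.
Unset Strict Implicit.
Unset Printing Implicit Defensive.

Import Order.TTheory GRing.Theory Num.Theory numFieldNormedType.Exports.

Local Open Scope classical_set_scope.
Local Open Scope ring_scope.

Definition is_distr (R : realType) (T : finType) (p : T -> R) : Prop :=
  (forall x, 0 <= p x <= 1) /\ \sum_x p x = 1.

Definition argmax (R : realType) (T : Type) (D : set T) (f : T -> R) : set T :=
  [set a | D a /\ forall a', D a' -> f a' <= f a].

Definition argmin (R : realType) (T : Type) (D : set T) (f : T -> R) : set T :=
  [set a | D a /\ forall a', D a' -> f a <= f a'].

(* R^Sd with the product topology. *)
Notation allocation R Sd := {ptws {s | s \in Sd} -> R}.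

Section MarkovDecisionProcess.
Context (R : realType) (S A : finType).
Implicit Types (pi f m : S -> A -> R).
Variables (tr : S -> A -> S -> R) (rho : S -> R) (gamma : R).

Definition is_kernel : Prop := forall s a, is_distr (tr s a).

Definition is_policy pi : Prop := forall s, is_distr (pi s).

Definition deterministic pi : Prop := forall s, exists a, pi s a = 1.

(* Probability under [pi] that the first [t.+1] state-action pairs are [w]. *)
Definition traj_prob pi (t : nat) (w : {ffun 'I_t.+1 -> S * A}) : R :=
  rho (w ord0).1
  * (\prod_(i < t.+1) pi (w i).1 (w i).2)
  * \prod_(i < t)
      tr (w (widen_ord (leqnSn t) i)).1 (w (widen_ord (leqnSn t) i)).2
         (w (lift ord0 i)).1.

Definition state_action_prob pi (t : nat) (s : S) (a : A) : R :=
  \sum_(w : {ffun 'I_t.+1 -> S * A} | w ord_max == (s, a)) traj_prob pi w.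

Definition occupancy pi : S -> A -> R := fun s a =>
  limn (series (fun t : nat => gamma ^+ t * state_action_prob pi t s a)).

Definition occupancies : set (S -> A -> R) :=
  [set m | (forall s a, 0 <= m s a) /\
    forall s, \sum_a m s a =
      rho s + gamma * \sum_s' \sum_a' tr s' a' s * m s' a'].

Definition det_occupancies : set (S -> A -> R) :=
  [set m | exists pi, [/\ is_policy pi, deterministic pi & m = occupancy pi]].

Definition inner f m : R := \sum_s \sum_a f s a * m s a.

Section RewardDesign.
Variables (r : S -> A -> R) (Sd : {set S}).

Definition admissible (C : R) : set (allocation R Sd) :=
  [set x | (forall s, 0 <= x s) /\ \sum_s x s <= C].

Definition follower_reward (x : allocation R Sd) : S -> A -> R := fun s a =>
  if insub s is Some i then r s a + x i else r s a.

Definition leader_reward : S -> A -> R := fun s _ =>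
  if s \in Sd then 1 else 0.

Definition BR (x : allocation R Sd) : set (S -> A -> R) :=
  argmax occupancies (inner (follower_reward x)).

(* [occupancies] is nonempty and compact, so the supremum is a maximum. *)
Definition BR_delta (delta : R) (x : allocation R Sd) : set (S -> A -> R) :=
  [set m | occupancies m /\
    sup [set inner (follower_reward x) m' | m' in occupancies]
      - inner (follower_reward x) m <= delta].

Definition optimal_solution (C : R) (x : allocation R Sd) (m : S -> A -> R) : Prop :=
  argmax [set p : allocation R Sd * (S -> A -> R) |
            [/\ admissible C p.1, occupancies p.2 & BR p.1 p.2]]
         (fun p => inner leader_reward p.2) (x, m).

Definition allocation_region (m : S -> A -> R) : set (allocation R Sd) :=
  [set x | BR x m].

Definition det_best_responses (x : allocation R Sd) : set (S -> A -> R) :=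
  det_occupancies `&` BR x.

(* A maximum over a finite set of policies; valued in the extended reals, where
   [ereal_sup set0 = -oo], the gap is [+oo] when every deterministic occupancy
   measure is a best response, and [+oo^-1 = 0]. *)
Definition reward_gap (x : allocation R Sd) (m : S -> A -> R) : \bar R :=
  ((inner (follower_reward x) m)%:E
   - ereal_sup [set (inner (follower_reward x) m')%:E
               | m' in det_occupancies `\` det_best_responses x])%E.

End RewardDesign.
End MarkovDecisionProcess.

(* Main.v *)
(* Let L, W be the leader's and follower's values and J = W(mstar).  Since xstar
   is interior, every best response d has L(d) >= L(mstar).  A deterministic d which
   is not a best response has W(d) <= J - b and L(d) >= 0.  Hence, with
   k = L(mstar)/b (or k = 0 when there is no such d), the linear functional
   L + k (J - W) is at least L(mstar) at every deterministic occupancy measure.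
   As a linear functional on the occupancy measures is optimised by a
   deterministic policy (Bellman's equation), the bound holds for every
   occupancy measure, in particular for m_delta, where J - W <= delta. *)
Require Import Defs.
From mathcomp Require Import all_boot all_order all_algebra.
From mathcomp Require Import all_classical all_reals all_analysis.
From mathcomp Require Import ring lra.
Import Order.TTheory GRing.Theory Num.Theory numFieldNormedType.Exports.
Local Open Scope classical_set_scope.
Local Open Scope ring_scope.

Section MDP.
Set Implicit Arguments.
Unset Strict Implicit.
Unset Printing Implicit Defensive.
Context (R : realType) (S A : finType).
Variables (tr : S -> A -> S -> R) (rho : S -> R) (gamma : R).
Hypothesis (tr_kernel : is_kernel tr) (gamma_range : 0 < gamma < 1).

Implicit Types (f m : S -> A -> R) (v : S -> R).

(** * Bellman optimality and linear programming duality over occupancy measures *)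

Definition backup f v (s : S) (a : A) : R :=
  f s a + gamma * \sum_s' tr s a s' * v s'.

Lemma backup_le f v w s a :
  (forall s', v s' <= w s') -> backup f v s a <= backup f w s a.
Proof.
move=> vw; have /andP[g0 _] := gamma_range.
rewrite lerD2l ler_wpM2l ?(ltW g0)//; apply: ler_sum => s' _.
by apply: ler_wpM2l => //; have [/(_ s')/andP[]] := tr_kernel s a.
Qed.

Lemma backup_cst f s a k : backup f (fun=> k) s a = f s a + gamma * k.
Proof. by rewrite /backup -big_distrl/= (tr_kernel s a).2 mul1r. Qed.

(* Knaster-Tarski: the optimal value function is the least [v] above all its
   backups, so no contraction argument is needed. *)
Lemma bellman_solution f (a0 : A) :
  exists v (c : S -> A),
    (forall s a, backup f v s a <= v s) /\ (forall s, v s = backup f v s (c s)).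
Proof.
have /andP[g0 g1] := gamma_range.
have [K fK] : exists K, forall s a, `|f s a| <= K.
  exists (\sum_s \sum_a `|f s a|) => s a.
  rewrite (bigD1 s)//= (bigD1 a)//= -addrA lerDl addr_ge0//.
    exact: sumr_ge0.
  by apply: sumr_ge0 => i _; exact: sumr_ge0.
pose super : set (S -> R) := [set u | forall s a, backup f u s a <= u s].
(* The fixed point of [t |-> K + gamma * t]: as a constant function it lies above its backups, and
   its opposite bounds every member of [super] from below. *)
pose k := K / (1 - gamma).
have kE : K = (1 - gamma) * k by rewrite /k mulrC divfK// subr_eq0 gt_eqF.
have super_k : super (fun=> k).
  move=> s a; rewrite backup_cst.
  have := fK s a; rewrite ler_norml => /andP[_]; rewrite kE; nra.
have super_ge u : super u -> forall s, - k <= u s.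
  move=> su s.
  (* At a state [s0] where [u] is least, backing up the constant [u s0] gives
     [f s0 a0 + gamma * u s0 <= u s0]. *)
  case: (@arg_minP _ _ _ s predT u isT) => s0 _ u_ge.
  apply: le_trans (u_ge s isT).
  have := @backup_le f (fun=> u s0) u s0 a0 (fun s' => u_ge s' isT).
  rewrite backup_cst => /le_trans/(_ (su s0 a0)).
  have := fK s0 a0; rewrite ler_norml => /andP[+ _]; rewrite kE; nra.
pose v s := inf [set u s | u in super].
have v_le u : super u -> forall s, v s <= u s.
  move=> su s; apply: ge_inf; last by exists u.
  by exists (- k) => _ [w sw <-]; exact: super_ge.
have super_v : super v.
  move=> s a; apply: lb_le_inf; first by exists k, (fun=> k).
  move=> _ [u su <-]; apply: le_trans (su s a).
  exact/backup_le/v_le.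
pose c s := [arg max_(a > a0) backup f v s a]%O.
have c_max s a : backup f v s a <= backup f v s (c s).
  by rewrite /c; case: arg_maxP => // i _ /(_ a isT).
exists v, c; split => // s; apply/le_anti; rewrite super_v andbT.
(* By monotonicity the greedy backup of [v] is again in [super], so leastness of [v] gives the
   missing inequality. *)
apply: (v_le (fun s => backup f v s (c s))) => {}s a.
by apply: le_trans (c_max s a); apply: backup_le => s'; exact: super_v.
Qed.

(** Weight the flow equation at [s] by [v s] and sum. The term in [rho] is the same for all [m], so
    maximising [inner f] amounts to minimising the total slack of [v]. *)
Lemma inner_backup f v m : occupancies tr rho gamma m ->
  inner f m = \sum_s rho s * v s - \sum_s \sum_a (v s - backup f v s a) * m s a.
Proof.
move=> [_ flow].
have vm : \sum_s \sum_a v s * m s a = \sum_s rho s * v s +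
    \sum_s \sum_a (gamma * \sum_s' tr s a s' * v s') * m s a.
  under eq_bigr => s _ do rewrite -big_distrr/= flow mulrDr [v s * rho s]mulrC.
  rewrite big_split/=; congr (_ + _).
  under eq_bigr => s _ do rewrite mulrCA.
  rewrite -mulr_sumr.
  under [RHS]eq_bigr => s _ do
    (under eq_bigr => a _ do rewrite -mulrA; rewrite -mulr_sumr).
  rewrite -mulr_sumr; congr (_ * _).
  under eq_bigr => s _ do rewrite mulr_sumr.
  rewrite exchange_big/=; apply: eq_bigr => s _.
  under eq_bigr => s' _ do rewrite mulr_sumr.
  rewrite exchange_big/=; apply: eq_bigr => a _.
  by rewrite mulr_suml; apply: eq_bigr => s' _; ring.
have -> : \sum_s \sum_a (v s - backup f v s a) * m s a =
    \sum_s \sum_a v s * m s a - inner f m -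
    \sum_s \sum_a (gamma * \sum_s' tr s a s' * v s') * m s a.
  rewrite /inner -!sumrB; apply: eq_bigr => s _.
  by rewrite -!sumrB; apply: eq_bigr => a _; rewrite /backup; ring.
rewrite vm; ring.
Qed.

(** * State-action probabilities and the flow equation for the measure induced by a policy *)

Section Occ.
Variable (pi : S -> A -> R).
Hypothesis (rho_distr : is_distr rho) (pi_policy : is_policy pi).

Definition traj_ext t (u : {ffun 'I_t.+1 -> S * A}) (x : S * A)
    : {ffun 'I_t.+2 -> S * A} :=
  [ffun i => if unlift ord_max i is Some j then u j else x].

Let p := state_action_prob tr rho pi.

Lemma widen_ord_lift n (i : 'I_n) : widen_ord (leqnSn n) i = lift ord_max i.
Proof. by apply: val_inj; rewrite /= /bump leqNgt ltn_ord. Qed.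

Lemma traj_extW t u x (i : 'I_t.+1) :
  traj_ext u x (widen_ord (leqnSn _) i) = u i.
Proof. by rewrite ffunE widen_ord_lift liftK. Qed.

Lemma traj_ext_max t u x : @traj_ext t u x ord_max = x.
Proof. by rewrite ffunE unlift_none. Qed.

(** The Markov property: the extra factor depends on [u] only through its last pair. *)
Lemma traj_prob_ext t (u : {ffun 'I_t.+1 -> S * A}) x :
  traj_prob tr rho pi (traj_ext u x) =
  traj_prob tr rho pi u * (tr (u ord_max).1 (u ord_max).2 x.1 * pi x.1 x.2).
Proof.
rewrite /traj_prob.
have -> : traj_ext u x ord0 = u ord0.
  by rewrite -(traj_extW u x); congr (_ _); exact: val_inj.
rewrite big_ord_recr/= traj_ext_max.
under eq_bigr => i _ do rewrite traj_extW.
rewrite [X in _ * X]big_ord_recr/= traj_extW.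
have -> : lift ord0 ord_max = ord_max :> 'I_t.+2 by exact: val_inj.
rewrite traj_ext_max.
under [X in _ * (X * _)]eq_bigr => i _.
  rewrite traj_extW.
  have -> : lift ord0 (widen_ord (leqnSn t) i) =
      widen_ord (leqnSn t.+1) (lift ord0 i) by exact: val_inj.
  rewrite traj_extW.
  over.
ring.
Qed.

Lemma state_action_prob0 s a : p 0 s a = rho s * pi s a.
Proof.
rewrite /p /state_action_prob (big_pred1 [ffun=> (s, a)]); last first.
  move=> w; apply/eqP/eqP => [wE|->]; last by rewrite ffunE.
  by apply/ffunP => i; rewrite ffunE (ord1 i) -wE; congr (w _); exact: val_inj.
by rewrite /traj_prob !ffunE big_ord_recl !big_ord0 !ffunE/= !mulr1.
Qed.

(** Dropping the last pair is a bijection from the trajectories that end at [(s, a)] onto all those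
    one step shorter, which are then grouped by their own last pair. *)
Lemma state_action_probS t s a :
  p t.+1 s a = (\sum_s' \sum_a' p t s' a' * tr s' a' s) * pi s a.
Proof.
rewrite {1}/p /state_action_prob.
rewrite (reindex_onto (fun u : {ffun 'I_t.+1 -> S * A} => traj_ext u (s, a))
  (fun w => [ffun j => w (widen_ord (leqnSn _) j)])); last first.
  move=> w /eqP wE; apply/ffunP => i; rewrite ffunE.
  case: unliftP => [j ->|->//].
  by rewrite ffunE widen_ord_lift.
rewrite (eq_bigl predT); last first.
  move=> u /=; rewrite traj_ext_max eqxx/=; apply/eqP/ffunP => j.
  by rewrite ffunE traj_extW.
under eq_bigr => u _ do rewrite traj_prob_ext/= mulrA.
rewrite -mulr_suml; congr (_ * _).
rewrite (partition_big (fun u : {ffun _} => u ord_max) predT)//=.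
rewrite pair_big/=; apply: eq_bigr => -[s' a'] _ /=.
rewrite /p /state_action_prob mulr_suml; apply: eq_bigr => u /eqP ->//.
Qed.

Lemma state_action_prob_ge0 t s a : 0 <= p t s a.
Proof.
have pi0 s' a' : 0 <= pi s' a' by have [/(_ a')/andP[]] := pi_policy s'.
elim: t s a => [|t IH] s a.
  by rewrite state_action_prob0 mulr_ge0//; have [/(_ s)/andP[]] := rho_distr.
rewrite state_action_probS mulr_ge0//.
apply: sumr_ge0 => s' _; apply: sumr_ge0 => a' _; rewrite mulr_ge0//.
by have [/(_ s)/andP[]] := tr_kernel s' a'.
Qed.

Lemma state_action_prob_sum t : \sum_s \sum_a p t s a = 1.
Proof.
elim: t => [|t IH].
  under eq_bigr => s _ do
    (under eq_bigr => a _ do rewrite state_action_prob0;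
     rewrite -mulr_sumr (pi_policy s).2 mulr1).
  exact: rho_distr.2.
under eq_bigr => s _ do
  (under eq_bigr => a _ do rewrite state_action_probS;
   rewrite -mulr_sumr (pi_policy s).2 mulr1).
rewrite -{}IH exchange_big/=; apply: eq_bigr => s _.
rewrite exchange_big/=; apply: eq_bigr => a _.
by rewrite -mulr_sumr (tr_kernel s a).2 mulr1.
Qed.

Lemma state_action_prob_le1 t s a : p t s a <= 1.
Proof.
rewrite -(state_action_prob_sum t) (bigD1 s)//= (bigD1 a)//= -addrA lerDl.
have p0 := state_action_prob_ge0 t.
by rewrite addr_ge0//; apply: sumr_ge0 => // i _; exact: sumr_ge0.
Qed.

Let dp s a t := gamma ^+ t * p t s a.

Lemma is_cvg_occupancy s a : cvgn (series (dp s a)).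
Proof.
have /andP[g0 g1] := gamma_range.
apply: (@series_le_cvg _ _ (geometric 1 gamma)) => [n|n|n|].
- by rewrite mulr_ge0 ?state_action_prob_ge0// exprn_ge0// ltW.
- by rewrite /= mul1r exprn_ge0// ltW.
- by rewrite /= mul1r ler_piMr ?state_action_prob_le1// exprn_ge0// ltW.
- by apply: is_cvg_geometric_series; rewrite ger0_norm// ltW.
Qed.

Lemma occupancy_cvg s a :
  series (dp s a) @ \oo --> occupancy tr rho gamma pi s a.
Proof. exact: is_cvg_occupancy. Qed.

Lemma occupancy_ge0 s a : 0 <= occupancy tr rho gamma pi s a.
Proof.
have /andP[g0 _] := gamma_range.
apply: limr_ge; first exact: is_cvg_occupancy.
apply: nearW => n; apply: sumr_ge0 => i _.
by rewrite mulr_ge0 ?state_action_prob_ge0// exprn_ge0// ltW.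
Qed.

(** Split off time 0, apply the one-step recursion to the later terms and pass to the limit. Summing
    over [a] gives the flow equation; the unsummed form also shows that the measure vanishes
    wherever [pi] does. *)
Lemma occupancyE s a : occupancy tr rho gamma pi s a =
  (rho s + gamma * \sum_s' \sum_a' tr s' a' s * occupancy tr rho gamma pi s' a')
  * pi s a.
Proof.
have l : (fun n => series (dp s a) n.+1) @ \oo --> occupancy tr rho gamma pi s a.
  by have := @occupancy_cvg s a; rewrite -(cvg_shiftS (series _)).
apply: (cvg_unique _ l); rewrite //=.
have -> : (fun n => series (dp s a) n.+1) = (fun n =>
    (rho s + gamma * \sum_s' \sum_a' tr s' a' s * series (dp s' a') n) * pi s a).
  apply/funext => n; rewrite /series/= big_nat_recl//= /dp expr0 mul1r.
  rewrite state_action_prob0 mulrDl; congr (_ + _).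
  under eq_bigr => i _ do rewrite state_action_probS mulrA.
  rewrite -mulr_suml; congr (_ * _).
  rewrite mulr_sumr.
  under [RHS]eq_bigr => s' _ do rewrite mulr_sumr.
  under [LHS]eq_bigr => i _ do
    (rewrite mulr_sumr; under eq_bigr => s' _ do rewrite mulr_sumr).
  rewrite exchange_big/=; apply: eq_bigr => s' _.
  rewrite exchange_big/=; apply: eq_bigr => a' _.
  rewrite !mulr_sumr; apply: eq_bigr => i _.
  by rewrite exprS; ring.
apply: cvgMl; apply: cvgD; first exact: cvg_cst.
apply: cvgMr; apply: cvg_big => [|s' _]; first exact: add_continuous.
apply: cvg_big => [|a' _]; first exact: add_continuous.
by apply: cvgMr; exact: occupancy_cvg.
Qed.

Lemma occupancy_in_occupancies :
  occupancies tr rho gamma (occupancy tr rho gamma pi).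
Proof.
split=> [|s]; first exact: occupancy_ge0.
under eq_bigr => a _ do rewrite occupancyE.
by rewrite -mulr_sumr (pi_policy s).2 mulr1.
Qed.

End Occ.

(** * Deterministic policies and their optimality for linear functionals *)

Definition det_policy (c : S -> A) : S -> A -> R := fun s a => (a == c s)%:R.

Lemma det_policyP (c : S -> A) :
  is_policy (det_policy c) /\ deterministic (det_policy c).
Proof.
split=> s; last by exists (c s); rewrite /det_policy eqxx.
split=> [a|]; first by rewrite /det_policy; case: eqP; rewrite lexx ler01.
rewrite (bigD1 (c s))//= /det_policy eqxx big1 ?addr0// => a /negPf.
by move=> ->.
Qed.

(** An action of probability 1 leaves no mass for the others. Taking [c] in a finite type lets
    [reward_gapP] choose a maximiser. *)
Lemma deterministic_policyE pi : is_policy pi -> deterministic pi ->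
  exists c : {ffun S -> A}, pi = det_policy c.
Proof.
move=> pip /choice[c c1]; exists (finfun c).
apply/funext => s; apply/funext => a; rewrite /det_policy ffunE.
have [->|ac] := eqVneq a (c s); first exact: c1.
have pi0 b : 0 <= pi s b by have [/(_ b)/andP[]] := pip s.
have := (pip s).2; rewrite (bigD1 (c s))//= c1 (bigD1 a)//= => e.
have : 0 <= \sum_(i | (i != c s) && (i != a)) pi s i by exact: sumr_ge0.
by have := pi0 a; move: e; set t := bigop _ _ _; lra.
Qed.

(** Complementary slackness: the slack of a Bellman solution [v] is nonnegative, and it is zero on
    the greedy actions, which carry all the mass of [d]. *)
Lemma det_occupancy_maximizer f (a0 : A) : is_distr rho ->
  exists2 d, det_occupancies tr rho gamma d &
    forall m, occupancies tr rho gamma m -> inner f m <= inner f d.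
Proof.
move=> rho_distr; have [v [c [vge vE]]] := bellman_solution f a0.
have [pip pid] := det_policyP c.
pose d := occupancy tr rho gamma (det_policy c).
exists d; first by exists (det_policy c).
have dM : occupancies tr rho gamma d by exact: occupancy_in_occupancies.
move=> m mM; rewrite (inner_backup f v mM) (inner_backup f v dM) lerD2l lerN2.
rewrite big1 => [|s _]; last first.
  apply: big1 => a _; rewrite /d occupancyE// /det_policy.
  by have [->|] := eqVneq a (c s); rewrite ?mulr0// {1}vE subrr mul0r.
apply: sumr_ge0 => s _; apply: sumr_ge0 => a _.
by rewrite mulr_ge0 ?subr_ge0// mM.1.
Qed.

Lemma inner_lin f g k l m :
  inner (fun s a => k * f s a + l * g s a) m = k * inner f m + l * inner g m.
Proof.
rewrite /inner !mulr_sumr -big_split; apply: eq_bigr => s _ /=.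
by rewrite !mulr_sumr -big_split; apply: eq_bigr => a _ /=; ring.
Qed.

Lemma det_occupancies_sub : is_distr rho ->
  det_occupancies tr rho gamma `<=` occupancies tr rho gamma.
Proof. by move=> ? _ [pi [? _ ->]]; exact: occupancy_in_occupancies. Qed.

(** * Perturbed allocations, the reward gap and the penalised leader reward *)

Section RewardDesign.
Variables (r : S -> A -> R) (Sd : {set S}).
Implicit Type x : allocation R Sd.

Lemma follower_reward_shift x e :
  follower_reward r ((fun i => x i + e) : allocation R Sd) =
  (fun s a => 1 * follower_reward r x s a + e * leader_reward R Sd s a).
Proof.
apply/funext => s; apply/funext => a; rewrite /follower_reward /leader_reward.
case: insubP => [i -> _|/negPf ->]; first by ring.
by rewrite mulr0 addr0 mul1r.
Qed.

Lemma leader_reward_ge0 m : occupancies tr rho gamma m ->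
  0 <= inner (leader_reward R Sd) m.
Proof.
move=> [m0 _]; apply: sumr_ge0 => s _; apply: sumr_ge0 => a _.
by rewrite mulr_ge0// /leader_reward; case: ifP.
Qed.

(* Lowering the whole allocation by a small [e] keeps [mstar] optimal, so no
   other best response can have a smaller leader reward. *)
Lemma interior_best_response x mstar m :
  interior (allocation_region tr rho gamma r mstar) x ->
  BR tr rho gamma r x m ->
  inner (leader_reward R Sd) mstar <= inner (leader_reward R Sd) m.
Proof.
move=> xint [mM mmax].
pose sh (e : R) : allocation R Sd := fun i => x i + e.
have shx : sh @ 0^'- --> x.
  (* The product topology is a supremum of coordinate topologies, so convergence is checked one
     coordinate at a time. *)
  apply/cvg_sup => i N; rewrite nbhsE => -[B [[U oU <-] Ux] UN].
  have shi : x i + e @[e --> 0^'-] --> x i.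
    rewrite -[X in _ --> X]addr0; apply: cvgD; first exact: cvg_cst.
    exact: cvg_at_left_filter.
  apply: filterS UN _; apply: shi; exact: open_nbhs_nbhs.
have [e [e0 [mstarM /(_ m mM)]]] : exists e : R,
    e < 0 /\ BR tr rho gamma r (sh e) mstar.
  have ev : \forall e \near 0^'-, BR tr rho gamma r (sh e) mstar by exact: (shx _ xint).
  by have [e []] := filter_ex (filterI (nbhs_left_lt 0) ev); exists e.
rewrite follower_reward_shift !inner_lin.
(* Optimality of [mstar] at [sh e] and of [m] at [x] leaves only the terms in [e]; as [e] is
   negative, the inequality reverses. *)
move=> mstar_e; rewrite -(ler_nM2l e0).
by move: mstar_e (mmax _ mstarM); lra.
Qed.

(** Deterministic policies are finite in number, so the supremum in [reward_gap] is attained unless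
    its range is empty, which is the case of an infinite gap. *)
Lemma reward_gapP x mstar : is_distr rho -> BR tr rho gamma r x mstar ->
  (det_occupancies tr rho gamma `<=` BR tr rho gamma r x /\
    reward_gap tr rho gamma r x mstar = +oo%E) \/
  exists b, [/\ 0 < b, reward_gap tr rho gamma r x mstar = b%:E &
    forall d, det_occupancies tr rho gamma d -> ~ BR tr rho gamma r x d ->
      inner (follower_reward r x) d <= inner (follower_reward r x) mstar - b].
Proof.
move=> rho_distr [mstarM mstarmax].
set f := follower_reward r x.
pose D := det_occupancies tr rho gamma `\` det_best_responses tr rho gamma r x.
have DP d : D d <-> det_occupancies tr rho gamma d /\ ~ BR tr rho gamma r x d.
  by split=> -[dd dnb]; split=> // dBR; apply: dnb; [split|case: dBR].
have [D0|/set0P[d1 Dd1]] := eqVneq D set0.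
  left; split=> [d dd|]; last by rewrite /reward_gap -/D D0 image_set0 ereal_sup0.
  by apply: contrapT => nb; have : D d by [exact/DP]; rewrite D0.
right; pose occ (c : {ffun S -> A}) := occupancy tr rho gamma (det_policy c).
have Docc d : D d -> exists c, d = occ c.
  by move=> [[pi [pp pd ->]] _]; have [c ->] := deterministic_policyE pp pd; exists c.
have [c1 d1E] := Docc _ Dd1.
pose inD c := `[< D (occ c) >].
have Pc1 : inD c1 by apply/asboolP; rewrite -d1E.
have [cmax /asboolP Dmax cmaxP] :=
  arg_maxP (P := inD) (fun c => inner f (occ c)) Pc1.
have [dmax ndmax] := (DP _).1 Dmax.
have supE : ereal_sup [set (inner f d)%:E | d in D] = (inner f (occ cmax))%:E.
  apply/le_anti/andP; split; last by apply: ereal_sup_ubound; exists (occ cmax).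
  apply: ge_ereal_sup => _ [d Dd <-]; have [c dE] := Docc _ Dd.
  by rewrite lee_fin dE; apply: cmaxP; apply/asboolP; rewrite -dE.
exists (inner f mstar - inner f (occ cmax)); split.
(* Otherwise [occ cmax] would do at least as well as [mstar] and be a best response. *)
- rewrite subr_gt0 ltNge; apply/negP => le; apply: ndmax.
  have dM := det_occupancies_sub rho_distr dmax.
  by split => // m mM; apply: le_trans le; exact: mstarmax.
- by rewrite /reward_gap -/f -/D supE.
- move=> d dd nd; have Dd : D d by exact/DP.
  have [c dE] := Docc _ Dd.
  by rewrite subKr dE; apply: cmaxP; apply/asboolP; rewrite -dE.
Qed.

(* [k] is the Lagrange multiplier of the constraint defining [BR_delta]. *)
Lemma leader_reward_penalized x mstar (a0 : A) (k : R) m :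
  is_distr rho ->
  interior (allocation_region tr rho gamma r mstar) x ->
  (forall d, det_occupancies tr rho gamma d -> ~ BR tr rho gamma r x d ->
    inner (leader_reward R Sd) mstar <=
    k * (inner (follower_reward r x) mstar - inner (follower_reward r x) d)) ->
  occupancies tr rho gamma m ->
  inner (leader_reward R Sd) mstar <= inner (leader_reward R Sd) m +
    k * (inner (follower_reward r x) mstar - inner (follower_reward r x) m).
Proof.
move=> rho_distr xint kP mM.
(* Maximising [k W - L] is minimising [L + k (J - W)], so it suffices to bound the latter at a
   deterministic [d]. *)
have [d dd dmax] := det_occupancy_maximizer
  (fun s a => k * follower_reward r x s a + -1 * leader_reward R Sd s a)
  a0 rho_distr.
have := dmax m mM; rewrite !inner_lin.
have [dBR|ndBR] := pselect (BR tr rho gamma r x d).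
  have [mstarM mstarmax] := interior_subset xint.
  have := interior_best_response xint dBR.
  have : inner (follower_reward r x) d = inner (follower_reward r x) mstar.
    by apply/le_anti/andP; split; [exact: mstarmax dBR.1|exact: dBR.2 mstarM].
  by move=> ->; lra.
have := leader_reward_ge0 (det_occupancies_sub rho_distr dd).
by have := kP d dd ndBR; lra.
Qed.

End RewardDesign.
End MDP.

Theorem proposition33 (R : realType) (S A : finType)
    (tr : S -> A -> S -> R) (r : S -> A -> R) (gamma : R) (rho : S -> R)
    (Sd : {set S}) (C : R)
    (S_nonempty : (0 < #|S|)%N) (A_nonempty : (0 < #|A|)%N)
    (tr_kernel : is_kernel tr) (gamma_range : 0 < gamma < 1)
    (rho_distr : is_distr rho) (Sd_nonempty : Sd != finset.set0) (C_ge0 : 0 <= C)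
    (xstar : allocation R Sd) (mstar : S -> A -> R)
    (star_optimal : optimal_solution tr rho gamma r C xstar mstar)
    (star_interior : interior (allocation_region tr rho gamma r mstar) xstar)
    (delta : R) (delta_gt0 : 0 < delta) (mdelta : S -> A -> R)
    (mdelta_argmin :
       argmin (BR_delta tr rho gamma r delta xstar)
              (inner (leader_reward R Sd)) mdelta) :
  ((1 - delta%:E / reward_gap tr rho gamma r xstar mstar)
     * (inner (leader_reward R Sd) mstar)%:E
   <= (inner (leader_reward R Sd) mdelta)%:E)%E.
Proof.
have [mdeltaBR _] := mdelta_argmin; have [mdM mdE] := mdeltaBR.
have mstarBR : BR tr rho gamma r xstar mstar := interior_subset star_interior.
have [mstarM mstarmax] := mstarBR.
have /card_gt0P[a0 _] := A_nonempty.
set J := inner (follower_reward r xstar) mstar in mstarmax.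
have gapd : J - inner (follower_reward r xstar) mdelta <= delta.
  (* [J] is both one of the values under the supremum and an upper bound for them. *)
  apply: le_trans mdE; rewrite lerD2r; apply: ub_le_sup; last by exists mstar.
  by exists J => _ [m' m'M <-]; exact: mstarmax.
have V0 := leader_reward_ge0 Sd mstarM.
have penalized k := leader_reward_penalized tr_kernel gamma_range a0
  (k := k) (m := mdelta) rho_distr star_interior.
have [[all_best ->]|[b [b0 -> bP]]] :=
    reward_gapP tr_kernel gamma_range rho_distr mstarBR.
  (* Infinite gap: the factor is 1, and the multiplier 0 suffices. *)
  rewrite invey mule0 sube0 mul1e lee_fin.
  have := penalized 0; rewrite mul0r addr0; apply=> // d dd nd.
  by case: nd; exact: all_best.
rewrite inver gt_eqF// -EFinM lee_fin.
set V := inner _ mstar in V0 *.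
(* The multiplier [V / b] turns a follower loss of at least [b] into a penalty of at least [V], and
   a loss of at most [delta] into one of at most [V / b * delta]. *)
have k0 : 0 <= V / b by rewrite divr_ge0// ltW.
have kb : V / b * b = V by rewrite divfK// gt_eqF.
have := penalized (V / b) _ mdM; rewrite -/V -/J.
have kdelta := ler_wpM2l k0 gapd.
have -> : (1 - delta / b) * V = V - V / b * delta by ring.
move=> V_le; rewrite lerBlDr; apply: le_trans (V_le _) _; last by rewrite lerD2l.
move=> d dd nd; rewrite -[X in X <= _]kb ler_wpM2l//.
by rewrite lerBrDl -lerBrDr; exact: bP.
Qed.
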